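(* Let $\Phi$ be (real) Gaussian white noise on the unit circle $\mathbb{T}\cong[0,2\pi]$ and let $\mathcal{P}\Phi$ be its Poisson extension to the open unit disk $\mathbb{D}$. Then for every $z\in\mathbb{D}$, the random variable $(\mathcal{P}\Phi)(z)$ has the distribution $$(\mathcal{P}\Phi)(z)=\mathcal{N}\left(0,\ \frac{1}{2\pi}+\frac1\pi\frac{|z|^2}{1-|z|^2}\right),$$ and for every $z\in\mathbb{D}$, the random variable $(\mathcal{P}\Phi)(z)-(\mathcal{P}\Phi)(0)$ has the distribution $$(\mathcal{P}\Phi)(z)-(\mathcal{P}\Phi)(0)=\mathcal{N}\left(0,\ \frac1\pi\frac{|z|^2}{1-|z|^2}\right).$$
   Context: $\mathcal{N}(\mu,v)$ denotes the Gaussian law on $\mathbb{R}$ with mean $\mu$ and variance $v$ (for $v=0$, the point mass at $\mu$). White noise $\Phi$ on $[0,2\pi]$ is normalized so that $\int_a^b\Phi(t)\,dt\sim\mathcal{N}(0,b-a)$ for every interval $[a,b]\subset[0,2\pi]$, with independent values over disjoint intervals; equivalently, it is given by a linear isometry $h\mapsto\int_0^{2\pi}h(t)\Phi(t)\,dt$ from real $L^2([0,2\pi],dt)$ into a space of centered jointly Gaussian random variables with the $L^2(\Omega)$ norm. The Poisson kernel is $$P_r(\theta)=\frac{1}{2\pi}\frac{1-r^2}{1-2r\cos\theta+r^2},\qquad0\le r<1,$$ and the Poisson extension is $(\mathcal{P}\Phi)(re^{i\theta})=\int_0^{2\pi}P_r(\theta-t)\Phi(t)\,dt$ for $re^{i\theta}\in\mathbb{D}$.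 *)

(* Defs.v *)
From HB Require Import structures.
From mathcomp Require Import all_boot all_order all_algebra.
From mathcomp Require Import complex.
From mathcomp Require Import all_classical all_reals all_analysis.
From mathcomp Require Import measurable_realfun.
From mathcomp Require Import ring lra.
Set Implicit Arguments.
Unset Strict Implicit.
Unset Printing Implicit Defensive.
Import Order.TTheory GRing.Theory Num.Theory.
Import numFieldNormedType.Exports.
Local Open Scope classical_set_scope.
Local Open Scope ring_scope.

(* [normal_prob m s] is parametrized by the standard deviation [s], and for
   [s = 0] it is not a point mass, hence the case distinction. *)
Definition normal_law (R : realType) (m v : R)
    : probability (measurableTypeR R) R :=
  if v == 0 then @dirac _ (measurableTypeR R) m R : probability _ _
  else normal_prob m (Num.sqrt v).

Definition has_law d (T : measurableType d) (R : realType)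
    (P : probability T R) (X : {RV P >-> R})
    (nu : probability (measurableTypeR R) R) :=
  forall A : set R, measurable A -> distribution P X A = nu A.
Arguments has_law {d T R} P X nu.

Definition circle_measure (R : realType)
    : {measure set (measurableTypeR R) -> \bar R} :=
  mrestr (@lebesgue_measure R) (measurable_itv `[0, 2 * pi]).

Definition circle_L2 (R : realType) := LfunType (circle_measure R) (lee1n 2).

Definition centered_jointly_gaussian d (T : measurableType d) (R : realType)
    (P : probability T R) (I : Type) (X : I -> {RV P >-> R}) :=
  forall (n : nat) (i : 'I_n -> I) (c : 'I_n -> R),
  exists2 v : R, 0 <= v &
    has_law P (\sum_(k < n) c k *: X (i k) : {mfun T >-> R}) (normal_law 0 v).
Arguments centered_jointly_gaussian {d T R} P {I} X.

(* [W h] is the stochastic integral of [h] against the noise over [0, 2pi].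
   Elements of L^2(Omega) are classes of random variables, so linearity is
   only required almost surely; that [W] is well defined on classes of
   functions [h] modulo null sets follows from linearity and isometry. *)
Record white_noise d (T : measurableType d) (R : realType)
    (P : probability T R) (W : circle_L2 R -> {RV P >-> R}) : Prop := {
  white_noise_linear : forall (a : R) (h k : circle_L2 R),
    (W (a *: h + k) : T -> R) = a *: W h + W k %[ae P] ;
  white_noise_isometry : forall h : circle_L2 R,
    Lnorm P 2%:E (EFin \o W h) = Lnorm (circle_measure R) 2%:E (EFin \o h) ;
  white_noise_gaussian : centered_jointly_gaussian P W
}.
Arguments white_noise {d T R} P W.

(* For |r| = 1 the numerator vanishes and [x / 0 = 0], so this is a bounded
   function of the angle for every real r; only 0 <= r < 1 is meaningful. *)
Definition poisson_kernel (R : realType) (r theta : R) : R :=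
  (2 * pi)^-1 * ((1 - r ^+ 2) / (1 - 2 * r * cos theta + r ^+ 2)).

Section poisson.
Variable R : realType.

Lemma circle_measureT : circle_measure R setT = (2 * pi : R)%:E.
Proof.
rewrite [LHS](_ : _ = lebesgue_measure `[0, 2 * pi : R]); last first.
  by rewrite /= /mrestr setTI.
rewrite lebesgue_measure_itv/= lte_fin.
by rewrite mulr_gt0 ?pi_gt0// oppr0 adde0.
Qed.

Lemma bounded_circle_L2 (f : R -> R) (M : R) : measurable_fun setT f ->
  (forall t, `|f t| <= M) -> f \in Lfun (circle_measure R) 2%:E.
Proof.
move=> mf fM; rewrite inE; apply/andP; split; rewrite inE//=.
rewrite /finite_norm unlock poweR_lty//.
apply: (@le_lt_trans _ _ (\int[circle_measure R]_x (M `^ 2)%:E)%E).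
  apply: ge0_le_integral => //=.
  - apply/measurable_EFinP.
    apply: (@measurableT_comp _ _ _ _ _ _ (@powR R ^~ 2)) => //.
    exact: measurableT_comp.
  - move=> x _; rewrite lee_fin ge0_ler_powR// nnegrE.
    exact: le_trans (fM 0).
by rewrite integral_cst// circle_measureT -EFinM ltry.
Qed.

Lemma poisson_slice_subproof (r theta : R) :
  (fun t => poisson_kernel r (theta - t)) \in Lfun (circle_measure R) 2%:E.
Proof.
have [r1|r1] := eqVneq (r ^+ 2) 1.
  apply: (@bounded_circle_L2 _ 0); rewrite /poisson_kernel r1 subrr.
    by under eq_fun do rewrite mul0r mulr0; exact: measurable_cst.
  by move=> t; rewrite mul0r mulr0 normr0.
pose D (x : R) := 1 - 2 * r * cos x + r ^+ 2.
have dE : 0 < (1 - `|r|) ^+ 2.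
  rewrite exprn_even_gt0//= subr_eq0; apply: contra_neq r1 => r1.
  by rewrite -real_normK ?num_real// -r1 expr1n.
have DE x : (1 - `|r|) ^+ 2 <= D x.
  have rc : r * cos x <= `|r|.
    rewrite (le_trans (ler_norm _))// normrM ler_piMr// ler_norml.
    by rewrite cos_le1 cos_geN1.
  have := real_normK (num_real r); rewrite /D; nra.
have D0 x : 0 < D x by exact: lt_le_trans (DE x).
apply: (@bounded_circle_L2 _
  ((2 * pi)^-1 * (`|1 - r ^+ 2| / (1 - `|r|) ^+ 2))).
  apply: continuous_measurable_fun => t.
  apply: cvgM; first exact: cvg_cst.
  apply: cvgM; first exact: cvg_cst.
  apply: (@cvgV _ _ _ _ (fun t => D (theta - t)) (D (theta - t))).
    by rewrite gt_eqF.
  apply: cvgD; last exact: cvg_cst.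
  apply: cvgB; first exact: cvg_cst.
  apply: cvgM; first exact: cvg_cst.
  apply: (@continuous_comp _ _ _ (fun t => theta - t) cos).
    by apply: cvgB; [exact: cvg_cst|exact: cvg_id].
  exact: continuous_cos.
move=> t; rewrite /poisson_kernel -/(D _) normrM ger0_norm; last first.
  by rewrite invr_ge0 mulr_ge0// pi_ge0.
rewrite ler_wpM2l ?invr_ge0 ?mulr_ge0 ?pi_ge0// normrM ler_wpM2l//.
by rewrite normfV gtr0_norm// lef_pV2 ?posrE.
Qed.

Definition poisson_slice (r theta : R) : circle_L2 R :=
  Lfun_Sub (lee1n 2) (poisson_slice_subproof r theta).

(* [carg 0] is a junk value; the Poisson kernel does not depend on the angle
   when r = 0. *)
Definition carg (z : R[i]) : R :=
  if 0 <= complex.Im z then acos (complex.Re z / Normc.normc z)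
  else - acos (complex.Re z / Normc.normc z).

Lemma cargP (z : R[i]) :
  z = Complex (Normc.normc z * cos (carg z)) (Normc.normc z * sin (carg z)).
Proof.
have [->|z0] := eqVneq z 0.
  by rewrite Normc.normc0 !mul0r.
have n0 : Normc.normc z != 0 by apply: contra_neq z0 => /Normc.eq0_normc.
case: z z0 n0 => x y _; rewrite /carg/=; set n := Num.sqrt _ => n0.
have ngt0 : 0 < n by rewrite lt_def n0 sqrtr_ge0.
have nE : n ^+ 2 = x ^+ 2 + y ^+ 2 by rewrite sqr_sqrtr// addr_ge0 ?sqr_ge0.
have xn : -1 <= x / n <= 1.
  rewrite -ler_norml normrM normfV (gtr0_norm ngt0) ler_pdivrMr// mul1r.
  by rewrite -sqrtr_sqr ler_wsqrtr// lerDl sqr_ge0.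
have cosE : n * cos (acos (x / n)) = x.
  by rewrite acosK ?in_itv//= mulrC divfK.
have sinE : n * sin (acos (x / n)) = `|y|.
  have -> : n * sin (acos (x / n)) = Num.sqrt (n ^+ 2 * (1 - (x / n) ^+ 2)).
    by rewrite sin_acos// sqrtrM ?sqr_ge0// sqrtr_sqr gtr0_norm.
  rewrite mulrBr mulr1 -exprMn mulrCA divff// mulr1 nE.
  by rewrite [x ^+ 2 + _]addrC addrK sqrtr_sqr.
case: ifPn => y0; first by rewrite cosE sinE ger0_norm.
by rewrite cosN sinN mulrN cosE sinE ltr0_norm ?opprK// ltNge.
Qed.

Definition poisson_extension d (T : measurableType d)
    (W : circle_L2 R -> {mfun T >-> R}) (z : R[i]) : {mfun T >-> R} :=
  W (poisson_slice (Normc.normc z) (carg z)).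

Lemma poisson_extension_polar d (T : measurableType d)
    (W : circle_L2 R -> {mfun T >-> R}) (r theta : R) : 0 <= r ->
  poisson_extension W (Complex (r * cos theta) (r * sin theta)) =
  W (poisson_slice r theta).
Proof.
move=> r0; rewrite /poisson_extension; set z := Complex _ _.
have nz : Normc.normc z = r.
  rewrite /= !exprMn -mulrDr cos2Dsin2 mulr1.
  by rewrite sqrtr_sqr ger0_norm.
have := cargP z; rewrite nz => -[cE sE].
congr W; apply/LfuneqP => t /=; rewrite /poisson_kernel.
suff : r * cos (carg z - t) = r * cos (theta - t) by rewrite -!mulrA => ->.
by rewrite !cosB !mulrDr !mulrA cE sE.
Qed.

End poisson.

(* Main.v *)
Require Import Defs.
From HB Require Import structures.
From mathcomp Require Import all_boot all_order all_algebra.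
From mathcomp Require Import complex.
From mathcomp Require Import all_classical all_reals all_analysis.
From mathcomp Require Import measurable_realfun.
From mathcomp Require Import ring lra.
Set Implicit Arguments.
Unset Strict Implicit.
Unset Printing Implicit Defensive.
Import Order.TTheory GRing.Theory Num.Theory.
Import numFieldNormedType.Exports.
Local Open Scope ring_scope.

(** Both random variables are finite linear combinations of values of the
    noise, hence centered Gaussian for some unknown variance [v]; only [v] has
    to be identified. A centered Gaussian of variance [v] has second moment [v]
    ([second_moment_normal_prob], [has_law_second_moment]), and by linearity
    and isometry the second moment of [b W(k) + W(h)] is the squared [L^2] norm
    of [b k + h] ([white_noise_comb_law]).

    It remains to compute deterministic integrals. At the origin the Poisson
    kernel is the constant [1/(2 pi)], so for both claims the function to be
    squared is [P_r(theta - t) - c/(2 pi)], with [c = 0] for the value at [z]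
    and [c = 1] for the increment. With [p = 2 pi P_r] this asks for the
    integrals of [p] and [p^2] over a period
    ([integral_poisson_kernel_sub_sqr]). Since [p] is the real part of
    [(1 + w)/(1 - w) = 1 + 2 w/(1 - w)] at [w = r e^{ix}], it has the primitive
    [x - 2 Im log(1 - w)], whose logarithmic term is periodic; and [p^2]
    differs from a constant multiple of [p] by the derivative of a periodic
    function. Hence [p] integrates to [2 pi] and [p^2] to
    [2 pi (1 + r^2)/(1 - r^2)]. *)

Local Open Scope classical_set_scope.

(** * Integration lemmas *)

Lemma derive_continuous (R : realType) (f : R -> R) (x l : R) :
  is_derive x 1 f l -> {for x, continuous f}.
Proof.
by move=> H; apply: differentiable_continuous; apply/derivable1_diffP; case: H.
Qed.

Lemma FTC2_is_derive (R : realType) (F f : R -> R) (a b : R) : a < b ->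
  (forall x : R, is_derive x 1 F (f x)) -> continuous f ->
  (\int[lebesgue_measure]_(x in `[a, b]) (f x)%:E = (F b - F a)%:E)%E.
Proof.
move=> ab dF cf; have cF : continuous F.
  by move=> x; exact: derive_continuous (dF x).
rewrite (@continuous_FTC2 _ _ F)//.
- exact: continuous_subspaceT.
- split.
  + by move=> x _; case: (dF x).
  + by apply: cvg_at_right_filter; exact: cF.
  + by apply: cvg_at_left_filter; exact: cF.
- by move=> x _; rewrite derive1E; exact: derive_val.
Qed.

Lemma integral_circle_measure (R : realType) (f : R -> \bar R) :
  measurable_fun setT f -> (forall x, 0 <= f x)%E ->
  (\int[circle_measure R]_x f x =
   \int[lebesgue_measure]_(x in `[0%R, (2 * pi)%R]) f x)%E.
Proof.
move=> mf f0; pose D : set R := `[0%R, (2 * pi)%R].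
have mD : measurable (D : set (measurableTypeR R)) by exact: measurable_itv.
have D0 : circle_measure R (~` D) = 0%E.
  rewrite [LHS](_ : _ = lebesgue_measure (~` D `&` D))//.
  by rewrite setICl measure0.
rewrite (ge0_negligible_integral (measurableC mD))// setTD setCK.
apply: eq_measure_integral => A mA sA.
by rewrite [LHS](_ : _ = lebesgue_measure (A `&` D))// setIidl.
Qed.

(** The density is a Radon-Nikodym derivative, and such derivatives are unique
    almost everywhere. *)
Lemma ge0_integral_normal_prob (R : realType) (m s : R) (f : R -> \bar R) :
  measurable_fun setT f -> (forall x, 0 <= f x)%E ->
  (\int[normal_prob m s]_x f x =
   \int[lebesgue_measure]_x (f x * (normal_pdf m s x)%:E))%E.
Proof.
move=> mf f0; have dom := @normal_prob_dominates R m s.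
have mpdf : measurable_fun setT (fun x => (normal_pdf m s x)%:E).
  by apply/measurable_EFinP; exact: measurable_normal_pdf.
rewrite -(Radon_Nikodym_SigmaFinite.change_of_variables dom)//.
have iRN := Radon_Nikodym_SigmaFinite.f_integrable dom.
apply: ae_eq_integral => //.
- by apply: emeasurable_funM => //; exact: measurable_int iRN.
- exact: emeasurable_funM.
- apply: ae_eqe_mul2l; apply: integral_ae_eq => //= E _ mE.
  by rewrite -Radon_Nikodym_SigmaFinite.f_integral.
Qed.

(** * The squared norm of the Poisson kernel *)

(** This is [|1 - r e^{ix}|^2]. *)
Definition poisson_den (R : realType) (r x : R) : R :=
  1 - 2 * r * cos x + r ^+ 2.

Lemma poisson_den_gt0 (R : realType) (r x : R) :
  0 <= r < 1 -> 0 < poisson_den r x.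
Proof.
move=> /andP[r0 r1]; rewrite /poisson_den.
have rc : r * cos x <= r by rewrite ler_piMr// cos_le1.
nra.
Qed.

Lemma rcos_lt1 (R : realType) (r x : R) : 0 <= r < 1 -> 0 < 1 - r * cos x.
Proof.
move=> /andP[r0 r1]; have : r * cos x <= r by rewrite ler_piMr// cos_le1.
lra.
Qed.

(** The arctangent is [- Im log(1 - r e^{ix})]: as [1 - r e^{ix}] stays in the
    right half plane, this primitive of [2 pi P_r] is smooth on the whole line,
    unlike the one given by the half-angle substitution. *)
Lemma is_derive_poisson_conj (R : realType) (r x : R) : 0 <= r < 1 ->
  is_derive x 1 (fun t => t + 2 * atan (r * sin t / (1 - r * cos t)))
    ((1 - r ^+ 2) / poisson_den r x).
Proof.
move=> r01; have u0 := gt_eqF (rcos_lt1 x r01).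
have d0 := gt_eqF (poisson_den_gt0 x r01).
have u0' : 1 - r * cos x != 0 by rewrite u0.
apply: is_derive_eq.
have dE : poisson_den r x = (1 - r * cos x) ^+ 2 + (r * sin x) ^+ 2.
  by rewrite exprMn sin2cos2 /poisson_den; ring.
have -> : 1 + (r * sin x / (1 - r * cos x)) ^+ 2 =
    poisson_den r x / (1 - r * cos x) ^+ 2.
  by rewrite dE; field.
rewrite /GRing.scale/=.
transitivity (1 + 2 * (r * cos x * (1 - r * cos x) - r ^+ 2 * sin x ^+ 2) /
    poisson_den r x).
  by field; rewrite u0 d0.
rewrite sin2cos2; move: d0 => /negbT d0.
by apply: (mulIf d0); rewrite mulrDl !divfK// /poisson_den; ring.
Qed.

(** A primitive of [p^2 - (1 + r^2)/(1 - r^2) p], for [p = 2 pi P_r]. It comes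
    from differentiating [sin x/D] and eliminating the cosine through
    [2 r cos x = 1 + r^2 - D], where [D] is the denominator. *)
Lemma is_derive_poisson_sin (R : realType) (r x : R) : 0 <= r < 1 ->
  is_derive x 1 (fun t => 2 * r * sin t / poisson_den r t)
    (((1 - r ^+ 2) / poisson_den r x) ^+ 2 -
     (1 + r ^+ 2) / (1 - r ^+ 2) * ((1 - r ^+ 2) / poisson_den r x)).
Proof.
move=> r01; have := gt_eqF (poisson_den_gt0 x r01).
have r21 : 1 - r ^+ 2 != 0.
  by rewrite subr_eq0 eq_sym lt_eqF// expr_lt1//; case/andP: r01.
rewrite /poisson_den => /negbT d0.
apply: is_derive_eq; rewrite /GRing.scale/=.
transitivity ((2 * r *
    (cos x * (1 - 2 * r * cos x + r ^+ 2) - 2 * r * sin x ^+ 2)) /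
    (1 - 2 * r * cos x + r ^+ 2) ^+ 2).
  by field.
by rewrite sin2cos2; field; rewrite ?d0 ?r21.
Qed.

(** The two periodic primitives contribute nothing over a full period, so only
    the linear part of the primitive of the square is left. *)
Lemma integral_poisson_kernel_sub_sqr (R : realType) (r theta c : R) :
  0 <= r < 1 ->
  (\int[lebesgue_measure]_(t in `[0%R, (2 * pi)%R])
     ((poisson_kernel r (theta - t) - c / (2 * pi)) ^+ 2)%:E =
  (((1 + r ^+ 2) / (1 - r ^+ 2) - 2 * c + c ^+ 2) / (2 * pi))%:E)%E.
Proof.
move=> r01.
have pi2 : 0 < 2 * pi :> R by rewrite mulr_gt0// pi_gt0.
have pi20 : 2 * pi != 0 :> R by rewrite gt_eqF.
pose p (x : R) := (1 - r ^+ 2) / poisson_den r x.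
pose k := (1 + r ^+ 2) / (1 - r ^+ 2).
pose G (x : R) : R := 2 * r * sin x / poisson_den r x +
  (k - 2 * c) * (x + 2 * atan (r * sin x / (1 - r * cos x))) + c ^+ 2 * x.
have dG (x : R) : is_derive x 1 G ((p x - c) ^+ 2).
  have h1 := is_derive_poisson_sin x r01.
  have h2 := is_derive_poisson_conj x r01.
  by apply: is_derive_eq; rewrite /GRing.scale/= -/(p x) -/k; ring.
have cp : continuous p.
  move=> x; apply: cvgM; first exact: cvg_cst.
  apply: cvgV; first by rewrite gt_eqF// poisson_den_gt0.
  by apply: (@derive_continuous _ _ _ _ _).
pose F (t : R) := - G (theta - t) / (2 * pi) ^+ 2.
pose f (t : R) : R := (poisson_kernel r (theta - t) - c / (2 * pi)) ^+ 2.
have fE t : f t = (p (theta - t) - c) ^+ 2 / (2 * pi) ^+ 2.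
  rewrite /f /poisson_kernel -/(poisson_den r _) -/(p _) {F f}.
  (* [2 * pi] is generalized because [field] would unfold [pi] *)
  by move: (2 * pi) pi20 => u u0; field.
have dF (t : R) : is_derive t 1 F (f t).
  have h := dG (theta - t).
  rewrite fE; apply: is_derive_eq; rewrite /GRing.scale/=.
  by move: (2 * pi) pi20 => u u0; field.
have cf : continuous f.
  have -> : f =
      (fun x => (p x - c) ^+ 2 / (2 * pi) ^+ 2) \o (fun t => theta - t).
    by apply/funext => t; rewrite fE.
  move=> t; apply: continuous_comp.
    by apply: cvgB; [exact: cvg_cst|exact: cvg_id].
  apply: cvgM; last exact: cvg_cst.
  apply: (@continuous_comp _ _ _ (fun x => p x - c) (fun x => x ^+ 2)).
    by apply: cvgB; [exact: cp|exact: cvg_cst].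
  exact: exprn_continuous.
rewrite (FTC2_is_derive pi2 dF cf); congr EFin.
have twopi : 2 * pi = pi *+ 2 :> R by rewrite mulr_natl.
rewrite /F /G /poisson_den subr0 sinB cosB twopi cos2pi sin2pi.
rewrite !(mulr0,mulr1,subr0,addr0) -twopi -/k.
move: (2 * pi) pi20 => u u0; field.
by rewrite u0 gt_eqF// (poisson_den_gt0 theta r01).
Qed.

Lemma poisson_kernel0 (R : realType) (x : R) :
  poisson_kernel 0 x = (2 * pi)^-1.
Proof.
by rewrite /poisson_kernel expr0n/= mulr0 mul0r !subr0 addr0 divr1 mulr1.
Qed.

(** * The second moment of a centered Gaussian law *)

(** A crude decay estimate, from [1 + y <= exp y]. *)
Lemma normal_pdf_bound (R : realType) (s x : R) : s != 0 -> 0 < x ->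
  s ^+ 2 * x * normal_pdf 0 s x <= normal_peak s * (2 * s ^+ 4) / x.
Proof.
move=> s0 x0; rewrite normal_pdfE// /normal_fun subr0 ler_pdivlMr//.
have p0 := normal_peak_ge0 s.
rewrite [leLHS](_ : _ = normal_peak s *
    (s ^+ 2 * (x ^+ 2 * expR (- x ^+ 2 / (s ^+ 2 *+ 2))))); last by ring.
rewrite ler_wpM2l//.
rewrite [leRHS](_ : _ = s ^+ 2 * (2 * s ^+ 2)); last by ring.
rewrite ler_wpM2l ?sqr_ge0// mulNr expRN.
rewrite ler_pdivrMr ?expR_gt0//.
have s20 : 0 < s ^+ 2 by rewrite exprn_even_gt0.
rewrite -ler_pdivrMl ?(mulr_gt0 _ s20)//.
apply: le_trans (expR_ge1Dx _).
by rewrite -[X in 1 + _ / X]mulr_natl mulrC lerDr; exact: ler01.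
Qed.

Lemma is_derive_normal_pdf (R : realType) (m s x : R) : s != 0 ->
  is_derive x 1 (normal_pdf m s) (- ((x - m) / s ^+ 2) * normal_pdf m s x).
Proof.
move=> s0; rewrite normal_pdfE// /normal_fun.
by apply: is_derive_eq; rewrite /GRing.scale/=; field.
Qed.

(** Integration by parts: the density [q] satisfies [s^2 q' = - x q], so
    [- s^2 x q] is a primitive of [x^2 q - s^2 q], and it vanishes at
    infinity. *)
Lemma second_moment_normal_prob (R : realType) (s : R) : s != 0 ->
  (\int[normal_prob 0 s]_x (x ^+ 2)%:E = (s ^+ 2)%:E)%E.
Proof.
move=> s0; rewrite ge0_integral_normal_prob; last 2 first.
- by apply/measurable_EFinP; exact: exprn_measurable.
- by move=> x; rewrite lee_fin sqr_ge0.
pose A (n : nat) : set (measurableTypeR R) := `[- n.+1%:R, n.+1%:R].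
have ndA : nondecreasing_seq A.
  move=> i j ij; apply/subsetPset => x; rewrite /A/= !in_itv/= => /andP[a b].
  have ij' : i.+1%:R <= j.+1%:R :> R by rewrite ler_nat.
  apply/andP; split; lra.
have UA : \bigcup_n A n = setT.
  apply/seteqP; split=> // x _; exists (Num.truncn `|x|) => //.
  by rewrite /A/= in_itv/= -ler_norml ltW// truncnS_gt.
pose f x : \bar R := (x ^+ 2 * normal_pdf 0 s x)%:E.
have mA n : measurable (A n) by exact: measurable_itv.
have mf n : measurable_fun (A n) f.
  apply: measurable_funTS; apply/measurable_EFinP.
  by apply: measurable_funM;
    [exact: exprn_measurable|exact: measurable_normal_pdf].
have f0 x : (0 <= f x)%E by rewrite lee_fin mulr_ge0 ?sqr_ge0 ?normal_pdf_ge0.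
have cf := ge0_nondecreasing_set_cvg_integral (mu := lebesgue_measure)
  ndA mA mf (fun n x _ => f0 x).
have mpdf : measurable_fun setT (fun x => (normal_pdf 0 s x)%:E).
  by apply/measurable_EFinP; exact: measurable_normal_pdf.
have cg := ge0_nondecreasing_set_cvg_integral (mu := lebesgue_measure) ndA mA
  (fun n => measurable_funTS mpdf) (fun n x _ => normal_pdf_ge0 0 s x).
rewrite UA integral_normal_pdf in cg; rewrite UA in cf.
(* the boundary term of the integration by parts over [A n] *)
pose e n : R := 2 * (s ^+ 2 * n.+1%:R * normal_pdf 0 s n.+1%:R).
have fE n : (\int[lebesgue_measure]_(x in A n) f x =
    (s ^+ 2)%:E * \int[lebesgue_measure]_(x in A n) (normal_pdf 0 s x)%:E
    - (e n)%:E)%E.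
  pose G (x : R) : R := - (s ^+ 2 * x * normal_pdf 0 s x).
  pose g (x : R) : R := x ^+ 2 * normal_pdf 0 s x - s ^+ 2 * normal_pdf 0 s x.
  have dG (x : R) : is_derive x 1 G (g x).
    have h := is_derive_normal_pdf 0 x s0.
    by apply: is_derive_eq; rewrite /g /GRing.scale/=; field.
  have cpdf := @continuous_normal_pdf _ 0 s s0.
  have cg' : continuous g.
    move=> x; apply: cvgB.
      by apply: cvgM; [exact: exprn_continuous|exact: cpdf].
    by apply: cvgM; [exact: cvg_cst|exact: cpdf].
  have cint (u : R -> R) : continuous u ->
      lebesgue_measure.-integrable (A n) (EFin \o u).
    move=> cu; apply: continuous_compact_integrable.
      exact: segment_compact.
    exact: continuous_subspaceT.
  have n0 : - n.+1%:R < n.+1%:R :> R by rewrite gtrN.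
  have -> : f = (fun x => (g x)%:E + (s ^+ 2)%:E * (normal_pdf 0 s x)%:E)%E.
    by apply/funext => x; rewrite /f /g -EFinM -EFinD subrK.
  rewrite integralD//; last 2 first.
  - exact: (cint _ cg').
  - by apply: integrableZl; [exact: mA|exact: (cint _ cpdf)].
  rewrite (integralZl (mA n) (cint _ cpdf)).
  rewrite addeC (FTC2_is_derive n0 dG cg') -EFinN /G; congr (_ + _%:E)%E.
  have -> : normal_pdf 0 s (- n.+1%:R) = normal_pdf 0 s n.+1%:R.
    by rewrite !normal_pdfE// /normal_fun !subr0 sqrrN.
  by rewrite /e; ring.
have e0 : e @ \oo --> (0 : R).
  pose C : R := 2 * (normal_peak s * (2 * s ^+ 4)).
  apply: (@squeeze_cvgr _ _ _ _ (cst 0) (fun n => C * harmonic n)); last 2 first.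
  - exact: cvg_cst.
  - rewrite -(mulr0 C); apply: cvgM; first exact: cvg_cst.
    exact: cvg_harmonic.
  apply: nearW => n; apply/andP; split; rewrite /= /e.
    by rewrite mulr_ge0// (mulr_ge0 (mulr_ge0 (sqr_ge0 _) _))// normal_pdf_ge0.
  by rewrite /C -[leRHS]mulrA ler_wpM2l//; exact: normal_pdf_bound.
have cs : (\int[lebesgue_measure]_(x in A n) f x @[n --> \oo] -->
    (s ^+ 2)%:E * 1 - 0)%E.
  under eq_fun do rewrite fE.
  apply: cvgeB; first by [].
    by apply: cvgeZl; [|exact: cg].
  by apply: cvg_EFin; [exact: nearW|exact: e0].
rewrite mule1 sube0 in cs.
have := cvg_unique _ cf cs; rewrite /f.
by under eq_integral do rewrite EFinM; apply.
Qed.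

(** * Laws of linear combinations of white noise *)

Lemma has_law_second_moment d (T : measurableType d) (R : realType)
    (P : probability T R) (X : {RV P >-> R}) (v : R) : 0 <= v ->
  has_law P X (normal_law 0 v) -> (\int[P]_w (X w ^+ 2)%:E = v%:E)%E.
Proof.
move=> v0 law.
have msq : measurable_fun setT (fun x : measurableTypeR R => (x ^+ 2)%:E).
  by apply/measurable_EFinP; exact: exprn_measurable.
have sq0 (x : R) : (0%:E <= (x ^+ 2)%:E)%E by rewrite lee_fin sqr_ge0.
(* [X] is repackaged with values in [measurableTypeR R], which has the same
   measurable sets as [R] but another display, so that its distribution and
   the normal law are measures on the same type *)
pose X' : T -> measurableTypeR R := X.
have mX' : measurable_fun setT X' by exact: (measurable_funPT X).
pose Y : {mfun T >-> measurableTypeR R} :=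
  HB.pack X' (isMeasurableFun.Build _ _ _ _ X' mX').
rewrite -(ge0_integral_distribution (P := P) Y msq sq0).
rewrite (eq_measure_integral (normal_law 0 v)); last first.
  by move=> A mA _; exact: law.
rewrite /normal_law; case: eqVneq => [->|vN0].
  by rewrite integral_dirac// diracT mul1e expr0n.
rewrite second_moment_normal_prob ?sqr_sqrtr//.
by rewrite gt_eqF// sqrtr_gt0 lt_def vN0.
Qed.

Lemma Lnorm2_sqr d (T : measurableType d) (R : realType)
    (mu : {measure set T -> \bar R}) (f : T -> R) :
  (Lnorm mu 2%:E (EFin \o f) `^ 2 = \int[mu]_x (f x ^+ 2)%:E)%E.
Proof.
rewrite poweR_Lnorm//; apply: eq_integral => x _.
by rewrite /= powR_mulrn// real_normK// num_real.
Qed.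

(** Joint Gaussianity gives the law up to its variance, which is read off the
    second moment. Linearity of the noise holds only almost surely, which is
    enough for the second moment. *)
Lemma white_noise_comb_law d (T : measurableType d) (R : realType)
    (P : probability T R) (W : circle_L2 R -> {RV P >-> R})
    (b v : R) (h k : circle_L2 R) : white_noise P W ->
  (\int[circle_measure R]_t ((b * k t + h t) ^+ 2)%:E = v%:E)%E ->
  has_law P (b *: W k + W h : {mfun T >-> R}) (normal_law 0 v).
Proof.
move=> [lin isom gauss] hv.
have [u u0] := gauss 2%N (tnth [tuple k; h]) (tnth [tuple b; 1]).
rewrite !big_ord_recl big_ord0 !(tnth0, tnthS) addr0 scale1r => law.
suff -> : v = u by [].
apply: EFin_inj; rewrite -(has_law_second_moment u0 law) -hv.
transitivity (\int[P]_w (W (b *: k + h) w ^+ 2)%:E)%E.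
  by rewrite -(Lnorm2_sqr P (W (b *: k + h))) isom Lnorm2_sqr.
apply: ge0_ae_eq_integral => //.
- by apply/measurable_EFinP; apply: measurable_funX.
- by apply/measurable_EFinP; apply: measurable_funX.
- by move=> w _; rewrite lee_fin sqr_ge0.
- by move=> w _; rewrite lee_fin sqr_ge0.
- by apply: filterS (lin b k h) => w /= + _ => ->.
Qed.

Lemma normc_itv01 (R : rcfType) (z : R[i]) : `|z| < 1 ->
  0 <= Normc.normc z < 1.
Proof. by case: z => x y; rewrite normc_def ltcR sqrtr_ge0. Qed.

Local Close Scope classical_set_scope.

Theorem theorem3 (R : realType) (d : measure_display) (T : measurableType d)
    (P : probability T R) (Phi : circle_L2 R -> {RV P >-> R})
    (hPhi : white_noise P Phi) :
  (forall z : R[i], `|z| < 1 ->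
    has_law P (poisson_extension Phi z)
      (normal_law 0 (1 / (2 * pi) +
        1 / pi * (Normc.normc z ^+ 2 / (1 - Normc.normc z ^+ 2))))) /\
  (forall z : R[i], `|z| < 1 ->
    has_law P (poisson_extension Phi z - poisson_extension Phi 0)
      (normal_law 0
        (1 / pi * (Normc.normc z ^+ 2 / (1 - Normc.normc z ^+ 2))))).
Proof.
have pi0 : (pi : R) != 0 by rewrite gt_eqF// pi_gt0.
have law (z : R[i]) (c : R) : `|z| < 1 ->
    has_law P (- c *: poisson_extension Phi 0 + poisson_extension Phi z
                : {mfun T >-> R})
      (normal_law 0 (((1 + Normc.normc z ^+ 2) / (1 - Normc.normc z ^+ 2)
                       - 2 * c + c ^+ 2) / (2 * pi))).
  move=> /normc_itv01 r01.
  apply: white_noise_comb_law => //.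
  rewrite -(integral_poisson_kernel_sub_sqr (carg z) c r01).
  rewrite -integral_circle_measure; last 2 first.
  - apply/measurable_EFinP; apply: measurable_funX; apply: measurable_funB => //.
    exact: measurable_funPT (poisson_slice (Normc.normc z) (carg z)).
  - by move=> t; rewrite lee_fin sqr_ge0.
  apply: eq_integral => t _; congr ((_ ^+ 2)%:E).
  by rewrite /= expr0n/= addr0 sqrtr0 poisson_kernel0 addrC mulNr.
have q (z : R[i]) : `|z| < 1 -> 1 - Normc.normc z ^+ 2 != 0.
  move=> /normc_itv01/andP[r0 r1].
  by rewrite subr_eq0 eq_sym lt_eqF// expr_lt1.
split=> z z1.
- have := law z 0 z1; rewrite oppr0 scale0r add0r.
  congr (has_law _ _ (normal_law _ _)).
  by move: q => /(_ _ z1) q; move: pi pi0 => u u0; field; rewrite u0 q.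
- have := law z 1 z1; rewrite scaleN1r addrC.
  congr (has_law _ _ (normal_law _ _)).
  by move: q => /(_ _ z1) q; move: pi pi0 => u u0; field; rewrite u0 q.
Qed.
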